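(* Let $n\ge1$ and let $Q$ be a subset of the Heisenberg group $H_n$. Let $\pi_n:H_n\to\mathbb R^{2n}$ be the projection $(t,\mathbf q,\mathbf p)\mapsto(\mathbf q,\mathbf p)$. Then $Q$ is a Kazhdan set in $H_n$ if and only if $\pi_n(Q)$ is a Kazhdan set in $\mathbb R^{2n}$.
   Context: The Heisenberg group $H_n$ is $\mathbb R\times\mathbb R^n\times\mathbb R^n$ with its usual topology and the group law $(t_1,\mathbf q_1,\mathbf p_1)\cdot(t_2,\mathbf q_2,\mathbf p_2)=(t_1+t_2+\tfrac12(\mathbf p_1\cdot\mathbf q_2-\mathbf p_2\cdot\mathbf q_1),\mathbf q_1+\mathbf q_2,\mathbf p_1+\mathbf p_2)$, where $\cdot$ is the Euclidean scalar product on $\mathbb R^n$. For a topological group $G$, a subset $Q$ is a Kazhdan set in $G$ if there exists $\varepsilon>0$ such that every strongly continuous unitary representation $\pi$ of $G$ on a complex Hilbert space having a vector $x$ with $\sup_{g\in Q}\|\pi(g)x-x\|<\varepsilon\|x\|$ has a non-zero $G$-invariant vector. *)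

(* Defs.v *)
From Stdlib Require Import Reals.
From Stdlib Require Fin.
Open Scope R_scope.

Record Cx := mkC { Re : R ; Im : R }.
Definition Cadd (a b : Cx) : Cx := mkC (Re a + Re b) (Im a + Im b).
Definition Cmul (a b : Cx) : Cx :=
  mkC (Re a * Re b - Im a * Im b) (Re a * Im b + Im a * Re b).
Definition Cconj (a : Cx) : Cx := mkC (Re a) (- Im a).
Definition Cone : Cx := mkC 1 0.

Record HilbertSpace := {
  hcar :> Type;
  hzero : hcar;
  hadd : hcar -> hcar -> hcar;
  hopp : hcar -> hcar;
  hscal : Cx -> hcar -> hcar;
  hinner : hcar -> hcar -> Cx;
  hadd_assoc : forall x y z, hadd x (hadd y z) = hadd (hadd x y) z;
  hadd_comm : forall x y, hadd x y = hadd y x;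
  hadd_zero : forall x, hadd x hzero = x;
  hadd_opp : forall x, hadd x (hopp x) = hzero;
  hscal_one : forall x, hscal Cone x = x;
  hscal_assoc : forall a b x, hscal a (hscal b x) = hscal (Cmul a b) x;
  hscal_addv : forall a x y, hscal a (hadd x y) = hadd (hscal a x) (hscal a y);
  hscal_addc : forall a b x, hscal (Cadd a b) x = hadd (hscal a x) (hscal b x);
  hinner_addl : forall x y z, hinner (hadd x y) z = Cadd (hinner x z) (hinner y z);
  hinner_scall : forall a x y, hinner (hscal a x) y = Cmul a (hinner x y);
  hinner_conj : forall x y, hinner y x = Cconj (hinner x y);
  hinner_pos : forall x, 0 <= Re (hinner x x);
  hinner_def : forall x, Re (hinner x x) = 0 -> x = hzero;
  hcomplete : forall u : nat -> hcar,
    (forall eps, eps > 0 -> exists N : nat, forall m k : nat, (N <= m)%nat -> (N <= k)%nat ->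
        sqrt (Re (hinner (hadd (u m) (hopp (u k))) (hadd (u m) (hopp (u k))))) < eps) ->
    exists l : hcar, forall eps, eps > 0 -> exists N : nat, forall m : nat, (N <= m)%nat ->
        sqrt (Re (hinner (hadd (u m) (hopp l)) (hadd (u m) (hopp l)))) < eps
}.

Definition hnorm (V : HilbertSpace) (x : V) : R := sqrt (Re (hinner V x x)).
Definition hsub (V : HilbertSpace) (x y : V) : V := hadd V x (hopp V y).

Definition unitary (V : HilbertSpace) (U : V -> V) : Prop :=
  (forall x y, U (hadd V x y) = hadd V (U x) (U y)) /\
  (forall a x, U (hscal V a x) = hscal V a (U x)) /\
  (forall x y, hinner V (U x) (U y) = hinner V x y) /\
  (forall y, exists x, U x = y).

Definition sc_unitary_rep {G : Type} (mul : G -> G -> G) (one : G) (dist : G -> G -> R)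
  (V : HilbertSpace) (pi : G -> V -> V) : Prop :=
  (forall g, unitary V (pi g)) /\
  (forall g h x, pi (mul g h) x = pi g (pi h x)) /\
  (forall x, pi one x = x) /\
  (forall g x eps, eps > 0 -> exists delta, delta > 0 /\
      forall h, dist g h < delta -> hnorm V (hsub V (pi h x) (pi g x)) < eps).

(* Kazhdan set. "sup_{g in Q} ||pi g x - x|| < eps ||x||" is encoded as the existence
   of a bound c >= 0 (sup over the empty set taken to be 0) *)
Definition Kazhdan_set {G : Type} (mul : G -> G -> G) (one : G) (dist : G -> G -> R)
  (Q : G -> Prop) : Prop :=
  exists eps, eps > 0 /\
    forall (V : HilbertSpace) (pi : G -> V -> V),
      sc_unitary_rep mul one dist V pi ->
      forall x : V,
        (exists c, 0 <= c /\ c < eps * hnorm V x /\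
           forall g, Q g -> hnorm V (hsub V (pi g x) x) <= c) ->
        exists y : V, y <> hzero V /\ forall g, pi g y = y.

Definition vec (n : nat) := Fin.t n -> R.

Fixpoint dot (n : nat) : vec n -> vec n -> R :=
  match n return vec n -> vec n -> R with
  | O => fun _ _ => 0
  | S m => fun u v => u Fin.F1 * v Fin.F1 + dot m (fun i => u (Fin.FS i)) (fun i => v (Fin.FS i))
  end.

Definition vadd {n} (u v : vec n) : vec n := fun i => u i + v i.
Definition vsub {n} (u v : vec n) : vec n := fun i => u i - v i.
Definition vzero {n} : vec n := fun _ => 0.
Definition vnorm {n} (u : vec n) : R := sqrt (dot n u u).

Definition R2n (n : nat) := (vec n * vec n)%type.
Definition r2n_add {n} (a b : R2n n) : R2n n := (vadd (fst a) (fst b), vadd (snd a) (snd b)).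
Definition r2n_zero {n} : R2n n := (vzero, vzero).
Definition r2n_dist {n} (a b : R2n n) : R :=
  sqrt (dot n (vsub (fst a) (fst b)) (vsub (fst a) (fst b))
        + dot n (vsub (snd a) (snd b)) (vsub (snd a) (snd b))).

Definition Heis (n : nat) := (R * R2n n)%type.
Definition heis_mul {n} (g h : Heis n) : Heis n :=
  let '(t1, (q1, p1)) := g in
  let '(t2, (q2, p2)) := h in
  (t1 + t2 + / 2 * (dot n p1 q2 - dot n p2 q1), (vadd q1 q2, vadd p1 p2)).
Definition heis_one {n} : Heis n := (0, r2n_zero).
Definition heis_dist {n} (g h : Heis n) : R :=
  sqrt ((fst g - fst h) ^ 2 + (r2n_dist (snd g) (snd h)) ^ 2).

Definition proj_n {n} (g : Heis n) : R2n n := snd g.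
Definition image_proj {n} (Q : Heis n -> Prop) : R2n n -> Prop :=
  fun y => exists g, Q g /\ proj_n g = y.

(* Main.v *)
Require Import Defs.
From Stdlib Require Import Reals Lra Lia.
From Stdlib Require Import FunctionalExtensionality ProofIrrelevance ClassicalEpsilon.
Open Scope R_scope.

(** A representation of [R^{2n}] is a representation of [H_n] trivial on the centre,
    which gives one implication.

    Conversely, let [x] be almost [Q]-invariant for a representation [rho] of [H_n], and
    split [x = x0 + x1] with [x0] fixed by the centre and [x1] orthogonal to all vectors
    fixed by the centre; both parts are almost [Q]-invariant.  If [x0] is large, [rho]
    restricted to the vectors fixed by the centre is a representation of [R^{2n}], and we are
    done.  If [x1] is large, choose by strong continuity a non-central [s] in [H_n] so close
    to [1] that [rho s x1] is almost [x1].  For [g] in [Q] the commutator [z = g s g^-1 s^-1] is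
    central and depends only on the projection of [g], through a homomorphism from [R^{2n}]
    onto the centre.  Pulling [rho] back along that homomorphism gives a representation of
    [R^{2n}] for which [rho s x1] is almost invariant under the projection of [Q], since
    [rho z (rho s x1) = rho g (rho s (rho g^-1 x1))].  So there is a non-zero vector fixed
    by the centre among those orthogonal to all such vectors, a contradiction. *)

(** * Real geometry of a complex Hilbert space *)

Definition rinner (V : HilbertSpace) (x y : V) : R := Re (hinner V x y).

Definition rscal (V : HilbertSpace) (r : R) (x : V) : V := hscal V (mkC r 0) x.

Section Geometry.
Variable V : HilbertSpace.
Implicit Types x y z : V.
Local Notation B := (rinner V).

Lemma rinner_addl x y z : B (hadd V x y) z = B x z + B y z.
Proof. unfold rinner. rewrite hinner_addl. reflexivity. Qed.

Lemma rinner_sym x y : B x y = B y x.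
Proof. unfold rinner. rewrite (hinner_conj V x y). reflexivity. Qed.

Lemma rinner_addr x y z : B x (hadd V y z) = B x y + B x z.
Proof. rewrite !(rinner_sym x). apply rinner_addl. Qed.

Lemma rinner_zerol y : B (hzero V) y = 0.
Proof.
  assert (H := rinner_addl (hzero V) (hzero V) y). rewrite hadd_zero in H. lra.
Qed.

Lemma rinner_oppl x y : B (hopp V x) y = - B x y.
Proof.
  assert (H := rinner_addl x (hopp V x) y). rewrite hadd_opp, rinner_zerol in H. lra.
Qed.

Lemma rinner_oppr x y : B x (hopp V y) = - B x y.
Proof. rewrite !(rinner_sym x). apply rinner_oppl. Qed.

Lemma rinner_rscall r x y : B (rscal V r x) y = r * B x y.
Proof. unfold rinner, rscal. rewrite hinner_scall. simpl. ring. Qed.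

Lemma rinner_rscalr r x y : B x (rscal V r y) = r * B x y.
Proof. rewrite !(rinner_sym x). apply rinner_rscall. Qed.

Lemma rinner_adjoint a x y : B (hscal V a x) y = B x (hscal V (Cconj a) y).
Proof.
  rewrite (rinner_sym x). unfold rinner. rewrite !hinner_scall, (hinner_conj V x y).
  simpl. ring.
Qed.

Lemma rinner_ext x y : (forall z, B x z = B y z) -> x = y.
Proof.
  intro H.
  assert (E : hadd V x (hopp V y) = hzero V).
  { apply hinner_def. fold (B (hadd V x (hopp V y)) (hadd V x (hopp V y))).
    rewrite rinner_addl, rinner_oppl, H. ring. }
  transitivity (hadd V (hadd V x (hopp V y)) y).
  - rewrite <- hadd_assoc, (hadd_comm V _ y), hadd_opp, hadd_zero. reflexivity.
  - rewrite E, hadd_comm. apply hadd_zero.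
Qed.

End Geometry.

Ltac rinner_expand :=
  unfold hsub;
  repeat first [ rewrite rinner_addl | rewrite rinner_addr | rewrite rinner_oppl
               | rewrite rinner_oppr | rewrite rinner_zerol | rewrite rinner_rscall
               | rewrite rinner_rscalr ].

(** Real inner products separate vectors, so an identity between real linear combinations of vectors
    reduces to linear arithmetic over the reals. *)
Ltac vector_eq := apply rinner_ext; intro; rinner_expand; try lra.

Section Norm.
Variable V : HilbertSpace.
Implicit Types x y z w : V.
Local Notation B := (rinner V).

Lemma hopp_rscal x : hopp V x = rscal V (-1) x.
Proof. vector_eq. Qed.

Lemma rinner_pos x : 0 <= B x x.
Proof. apply hinner_pos. Qed.

Lemma hnorm_pos x : 0 <= hnorm V x.
Proof. apply sqrt_pos. Qed.

Lemma hnorm_sqr x : hnorm V x * hnorm V x = B x x.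
Proof. apply sqrt_sqrt, hinner_pos. Qed.

Lemma hnorm_zero : hnorm V (hzero V) = 0.
Proof.
  unfold hnorm. fold (B (hzero V) (hzero V)). rewrite rinner_zerol. apply sqrt_0.
Qed.

Lemma hnorm_eq0 x : hnorm V x = 0 -> x = hzero V.
Proof.
  intro H. apply hinner_def. fold (B x x). rewrite <- hnorm_sqr, H. ring.
Qed.

Lemma cauchy_schwarz x y : B x y <= hnorm V x * hnorm V y.
Proof.
  assert (Hx := hnorm_pos x). assert (Hy := hnorm_pos y).
  assert (Hxx := hnorm_sqr x). assert (Hyy := hnorm_sqr y).
  destruct (Rle_lt_or_eq_dec _ _ Hx) as [Px|Px].
  2:{ rewrite (hnorm_eq0 x), rinner_zerol; [|easy]. rewrite hnorm_zero. lra. }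
  destruct (Rle_lt_or_eq_dec _ _ Hy) as [Py|Py].
  2:{ rewrite (hnorm_eq0 y), rinner_sym, rinner_zerol; [|easy]. rewrite hnorm_zero. lra. }
  (* With norms written |x| and |y|, [B z z] expands to 2|x||y|(|x||y| - [B x y]). *)
  set (z := hsub V (rscal V (hnorm V y) x) (rscal V (hnorm V x) y)).
  assert (Hz : 0 <= B z z) by apply rinner_pos.
  unfold z in Hz. revert Hz. rinner_expand. rewrite (rinner_sym V y x), <- Hxx, <- Hyy.
  intro Hz.
  assert (0 < hnorm V x * hnorm V y) by (apply Rmult_lt_0_compat; assumption).
  apply (Rmult_le_reg_l (hnorm V x * hnorm V y)); [assumption|]. nra.
Qed.

Lemma hnorm_triangle x y : hnorm V (hadd V x y) <= hnorm V x + hnorm V y.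
Proof.
  assert (H := cauchy_schwarz x y). assert (Hs := hnorm_sqr (hadd V x y)).
  revert Hs. rinner_expand. rewrite (rinner_sym V y x), <- !hnorm_sqr. intro Hs.
  assert (Hx := hnorm_pos x). assert (Hy := hnorm_pos y).
  apply Rsqr_incr_0_var; [unfold Rsqr; nra | lra].
Qed.

Definition hdist x y := hnorm V (hsub V x y).

Lemma hdist_triangle x y z : hdist x z <= hdist x y + hdist y z.
Proof.
  unfold hdist. replace (hsub V x z) with (hadd V (hsub V x y) (hsub V y z)) by vector_eq.
  apply hnorm_triangle.
Qed.

Lemma hdist_sym x y : hdist x y = hdist y x.
Proof.
  unfold hdist, hnorm. f_equal. fold (B (hsub V x y) (hsub V x y)).
  fold (B (hsub V y x) (hsub V y x)). rinner_expand. lra.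
Qed.

Lemma hdist_eq0 x y : hdist x y = 0 -> x = y.
Proof.
  intro H. apply hnorm_eq0 in H.
  apply rinner_ext. intro z.
  assert (E : B (hsub V x y) z = 0) by (rewrite H; apply rinner_zerol).
  revert E. rinner_expand. lra.
Qed.

Lemma hdist_small x y : (forall eps, eps > 0 -> hdist x y <= eps) -> x = y.
Proof.
  intro H. apply hdist_eq0.
  destruct (Rle_lt_or_eq_dec _ _ (hnorm_pos (hsub V x y))) as [P|P]; [|easy].
  fold (hdist x y) in P. specialize (H (hdist x y / 2)). lra.
Qed.

(** * Closed subspaces and orthogonal projection *)

Definition converges (u : nat -> V) (l : V) : Prop :=
  forall eps, eps > 0 -> exists N : nat, forall m : nat, (N <= m)%nat -> hdist (u m) l < eps.

Record closed_subspace (W : V -> Prop) : Prop := {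
  cs_zero : W (hzero V);
  cs_add : forall x y, W x -> W y -> W (hadd V x y);
  cs_scal : forall a x, W x -> W (hscal V a x);
  cs_lim : forall u l, (forall k, W (u k)) -> converges u l -> W l }.

Lemma cs_opp W (HW : closed_subspace W) x : W x -> W (hopp V x).
Proof. intro H. rewrite hopp_rscal. exact (cs_scal W HW _ _ H). Qed.

(** Only the real part is asked to vanish. For a complex subspace [W] this is full orthogonality,
    since multiplying [w] by i brings in the imaginary part. *)
Definition orthogonal (W : V -> Prop) : V -> Prop := fun y => forall w, W w -> B y w = 0.

Lemma orthogonal_closed W : closed_subspace W -> closed_subspace (orthogonal W).
Proof.
  intro HW. split; unfold orthogonal.
  - intros w _. apply rinner_zerol.
  - intros x y Hx Hy w Hw. rewrite rinner_addl, Hx, Hy; auto. ring.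
  - intros a x Hx w Hw. rewrite rinner_adjoint. apply Hx. exact (cs_scal W HW _ _ Hw).
  - intros u l Hu Hl.
    (* An upper bound is enough: it is applied to [w] and to its opposite. *)
    assert (K : forall w, W w -> B l w <= 0).
    { intros w Hw. apply Rnot_lt_le. intro P.
      assert (Hn := hnorm_pos w).
      destruct (Hl (B l w / (hnorm V w + 1))) as [N HN].
      { apply Rdiv_lt_0_compat; lra. }
      specialize (HN N (le_n N)). rewrite hdist_sym in HN.
      assert (C := cauchy_schwarz (hsub V l (u N)) w).
      revert C. fold (hdist l (u N)). rinner_expand. rewrite (Hu N w Hw). intro C.
      assert (D : hdist l (u N) * (hnorm V w + 1) < B l w).
      { apply (Rmult_lt_compat_r (hnorm V w + 1)) in HN; [|lra].
        unfold Rdiv in HN. rewrite Rmult_assoc, Rinv_l, Rmult_1_r in HN; lra. }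
      assert (E := hnorm_pos (hsub V l (u N))). fold (hdist l (u N)) in E. nra. }
    intros w Hw. assert (K1 := K w Hw). assert (K2 := K (hopp V w) (cs_opp W HW w Hw)).
    rewrite rinner_oppr in K2. lra.
Qed.

(** The point of [W] nearest to [x] is the limit of a minimizing sequence, which is Cauchy by the
    parallelogram law. Minimality along lines in [W] gives orthogonality. *)
Lemma projection_exists W (HW : closed_subspace W) x :
  exists w, W w /\ orthogonal W (hsub V x w).
Proof.
  (* Squared distances are negated because [completeness] provides suprema; [m] below is their
     infimum. *)
  set (E := fun r => exists w, W w /\ r = - B (hsub V x w) (hsub V x w)).
  destruct (completeness E) as [M [HM1 HM2]].
  { exists 0. intros r [w [_ ->]]. assert (H := rinner_pos (hsub V x w)). lra. }
  { exists (- B (hsub V x (hzero V)) (hsub V x (hzero V))), (hzero V).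
    split; [apply (cs_zero W HW)|reflexivity]. }
  set (m := - M).
  assert (Hm : forall w, W w -> m <= B (hsub V x w) (hsub V x w)).
  { intros w Hw. unfold m. assert (H := HM1 _ (ex_intro _ w (conj Hw eq_refl))).
    lra. }
  assert (Hinf : forall k : nat, exists w, W w /\
            B (hsub V x w) (hsub V x w) < m + / (INR k + 1)).
  { intro k. assert (Pk : 0 < / (INR k + 1)).
    { apply Rinv_0_lt_compat. assert (H := pos_INR k). lra. }
    apply NNPP. intro H.
    assert (M <= M - / (INR k + 1)); [|lra].
    apply HM2. intros r [w [Hw ->]]. apply Rnot_lt_le. intro L. apply H. exists w.
    split; [assumption|]. unfold m. lra. }
  destruct (choice _ Hinf) as [u Hu].
  assert (Hsmall : forall d, d > 0 -> exists N : nat, forall k, (N <= k)%nat ->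
            / (INR k + 1) < d).
  { intros d Hd. destruct (archimed_cor1 d Hd) as [N [HN PN]]. exists N. intros k Hk.
    apply lt_0_INR in PN. apply le_INR in Hk.
    apply Rle_lt_trans with (/ INR N); [|assumption].
    apply Rinv_le_contravar; lra. }
  (* Parallelogram law: the midpoint of [u j] and [u k] lies in [W], so its squared distance to [x]
     is at least [m]. *)
  assert (Hpar : forall j k, hdist (u j) (u k) * hdist (u j) (u k)
            <= 2 * / (INR j + 1) + 2 * / (INR k + 1)).
  { intros j k. unfold hdist. rewrite hnorm_sqr.
    destruct (Hu j) as [Wj Lj]. destruct (Hu k) as [Wk Lk].
    assert (H := Hm (rscal V (/2) (hadd V (u j) (u k)))
                   (cs_scal W HW _ _ (cs_add W HW _ _ Wj Wk))).
    revert H Lj Lk. rinner_expand.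
    rewrite (rinner_sym V (u j) x), (rinner_sym V (u k) x), (rinner_sym V (u k) (u j)).
    lra. }
  destruct (hcomplete V u) as [l Hl].
  { intros eps He. destruct (Hsmall (eps * eps / 4)) as [N HN]; [nra|].
    exists N. intros j k Hj Hk. apply HN in Hj. apply HN in Hk.
    specialize (Hpar j k). change (hdist (u j) (u k) < eps).
    apply Rnot_le_lt. intro L. nra. }
  change (converges u l) in Hl.
  assert (Wl : W l) by (apply (cs_lim W HW u); [intro k; apply Hu | assumption]).
  exists l. split; [assumption|].
  assert (Hmin : B (hsub V x l) (hsub V x l) <= m).
  { apply Rnot_lt_le. intro P.
    assert (m0 : 0 <= m).
    { apply Rnot_lt_le. intro L. destruct (Hsmall (- m)) as [N HN]; [lra|].
      specialize (HN N (le_n N)). destruct (Hu N) as [_ LN].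
      assert (Q := rinner_pos (hsub V x (u N))). lra. }
    set (D := hdist x l). assert (D0 : 0 <= D) by apply hnorm_pos.
    assert (DD : D * D = B (hsub V x l) (hsub V x l)) by apply hnorm_sqr.
    rewrite <- DD in P.
    assert (Dp : 0 < D) by nra.
    set (gap := D * D - m).
    destruct (Hl (gap / (4 * D))) as [N1 HN1].
    { unfold gap. apply Rdiv_lt_0_compat; lra. }
    destruct (Hsmall (gap / 4)) as [N2 HN2]; [unfold gap; lra|].
    set (k := Nat.max N1 N2).
    specialize (HN1 k (Nat.le_max_l _ _)). specialize (HN2 k (Nat.le_max_r _ _)).
    destruct (Hu k) as [_ Lk]. rewrite <- hnorm_sqr in Lk. fold (hdist x (u k)) in Lk.
    assert (T := hdist_triangle x (u k) l). fold D in T.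
    assert (A0 : 0 <= hdist x (u k)) by apply hnorm_pos.
    assert (S : hdist (u k) l * (4 * D) < gap).
    { apply (Rmult_lt_compat_r (4 * D)) in HN1; [|lra].
      unfold Rdiv in HN1. rewrite Rmult_assoc, Rinv_l, Rmult_1_r in HN1; lra. }
    assert (B0 : 0 <= hdist (u k) l) by apply hnorm_pos.
    (* If [hdist (u k) l <= D], squaring the triangle inequality [T] gives [gap] < [gap]/2 +
       [gap]/4. Otherwise [hdist (u k) l * (4 * D)] exceeds 4[D]^2, which is at least [gap] because
       [m >= 0]. *)
    destruct (Rle_lt_dec (hdist (u k) l) D).
    - unfold gap in *. nra.
    - unfold gap in *. nra. }
  intros w Hw.
  assert (Hvar : forall r, 0 <= - 2 * r * B (hsub V x l) w + r * r * B w w).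
  { intro r.
    assert (H := Hm (hadd V l (rscal V r w)) (cs_add W HW _ _ Wl (cs_scal W HW _ _ Hw))).
    replace (hsub V x (hadd V l (rscal V r w)))
      with (hsub V (hsub V x l) (rscal V r w)) in H by vector_eq.
    revert H Hmin. generalize (hsub V x l). intro d. rinner_expand.
    rewrite (rinner_sym V w d). lra. }
  assert (Hww := rinner_pos w).
  set (b := B (hsub V x l) w) in *.
  (* With this [t], the variation equals -[t]^2 ([B w w] + 2), which forces [t = 0]. The added 1
     keeps the denominator positive when [w] is zero. *)
  specialize (Hvar (b / (B w w + 1))).
  set (t := b / (B w w + 1)) in Hvar.
  assert (Et : b = t * (B w w + 1)) by (unfold t; field; lra).
  rewrite Et in Hvar. assert (t * t * (B w w + 2) <= 0) by nra.
  assert (t = 0) by nra. rewrite Et, H0. ring.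
Qed.

End Norm.

(** * Closed subspaces as Hilbert spaces *)

Section SubHilbert.
Variables (V : HilbertSpace) (W : V -> Prop) (HW : closed_subspace V W).

Lemma subspace_eq (x y : {v : V | W v}) : proj1_sig x = proj1_sig y -> x = y.
Proof.
  destruct x as [x Hx], y as [y Hy]. simpl. intro E. subst y. f_equal.
  apply proof_irrelevance.
Qed.

(** The Kazhdan hypothesis has to be applied to subrepresentations, so a closed subspace must be a
    Hilbert space itself. Cauchy sequences converge in [V], and closedness keeps the limit in
    [W]. *)
Definition sub_hilbert : HilbertSpace.
Proof.
  unshelve refine {|
    hcar := {v : V | W v};
    hzero := exist _ (hzero V) (cs_zero V W HW);
    hadd := fun x y => exist _ (hadd V (proj1_sig x) (proj1_sig y))
                         (cs_add V W HW _ _ (proj2_sig x) (proj2_sig y));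
    hopp := fun x => exist _ (hopp V (proj1_sig x)) (cs_opp V W HW _ (proj2_sig x));
    hscal := fun a x => exist _ (hscal V a (proj1_sig x))
                          (cs_scal V W HW a _ (proj2_sig x));
    hinner := fun x y => hinner V (proj1_sig x) (proj1_sig y) |};
    intros; try (apply subspace_eq); simpl.
  - apply hadd_assoc.
  - apply hadd_comm.
  - apply hadd_zero.
  - apply hadd_opp.
  - apply hscal_one.
  - apply hscal_assoc.
  - apply hscal_addv.
  - apply hscal_addc.
  - apply hinner_addl.
  - apply hinner_scall.
  - apply hinner_conj.
  - apply hinner_pos.
  - apply hinner_def. assumption.
  - destruct (hcomplete V (fun k => proj1_sig (u k)) H) as [l Hl].
    assert (Wl : W l).
    { apply (cs_lim V W HW (fun k => proj1_sig (u k))); [|exact Hl].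
      intro k. exact (proj2_sig (u k)). }
    exists (exist _ l Wl). exact Hl.
Defined.

End SubHilbert.

(** * Unitary representations *)

Section Unitary.
Variables (V : HilbertSpace) (U : V -> V) (HU : unitary V U).

Lemma unitary_sub x y : U (hsub V x y) = hsub V (U x) (U y).
Proof.
  destruct HU as [Ha [Hs _]]. unfold hsub. rewrite Ha. f_equal.
  rewrite !hopp_rscal. apply Hs.
Qed.

Lemma unitary_rinner x y : rinner V (U x) (U y) = rinner V x y.
Proof. unfold rinner. f_equal. apply HU. Qed.

Lemma unitary_norm x : hnorm V (U x) = hnorm V x.
Proof. unfold hnorm. do 2 f_equal. apply HU. Qed.

Lemma unitary_dist x y : hdist V (U x) (U y) = hdist V x y.
Proof. unfold hdist. rewrite <- unitary_sub. apply unitary_norm. Qed.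

End Unitary.

Section Restriction.
Context {G : Type} (mul : G -> G -> G) (one : G) (dist : G -> G -> R) (inv : G -> G).
Hypothesis mul_inv : forall g, mul g (inv g) = one.
Variables (V : HilbertSpace) (pi : G -> V -> V).
Hypothesis Hpi : sc_unitary_rep mul one dist V pi.
Variables (W : V -> Prop) (HW : closed_subspace V W).
Hypothesis W_stable : forall g x, W x -> W (pi g x).

Definition restrict_rep (g : G) (x : sub_hilbert V W HW) : sub_hilbert V W HW :=
  exist _ (pi g (proj1_sig x)) (W_stable g _ (proj2_sig x)).

Lemma restrict_rep_sc : sc_unitary_rep mul one dist (sub_hilbert V W HW) restrict_rep.
Proof.
  destruct Hpi as [Hu [Hm [H1 Hc]]].
  split; [|split; [|split]].
  - intro g. destruct (Hu g) as [Ha [Hs [Hi _]]]. split; [|split; [|split]].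
    + intros x y. apply subspace_eq, Ha.
    + intros a x. apply subspace_eq, Hs.
    + intros x y. apply Hi.
    (* Surjectivity on [W] uses that [W] is stable under the inverse of [g] as well. *)
    + intro y. exists (restrict_rep (inv g) y). apply subspace_eq. simpl.
      rewrite <- Hm, mul_inv. apply H1.
  - intros g h x. apply subspace_eq, Hm.
  - intro x. apply subspace_eq, H1.
  - intros g x. exact (Hc g (proj1_sig x)).
Qed.

End Restriction.

(** * Invariant subspaces and their orthogonal complements *)

Section InvariantSubspaces.
Context {G : Type} (mul : G -> G -> G) (one : G) (dist : G -> G -> R) (inv : G -> G).
Hypothesis mul_inv : forall g, mul g (inv g) = one.
Variables (V : HilbertSpace) (pi : G -> V -> V).
Hypothesis Hpi : sc_unitary_rep mul one dist V pi.

Definition fixed_by (Z : G -> Prop) : V -> Prop := fun x => forall z, Z z -> pi z x = x.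

Lemma fixed_by_closed Z : closed_subspace V (fixed_by Z).
Proof.
  destruct Hpi as [Hu _].
  split; unfold fixed_by.
  - intros z _. apply hnorm_eq0. rewrite unitary_norm by apply Hu. apply hnorm_zero.
  - intros x y Hx Hy z Hz. destruct (Hu z) as [Ha _]. rewrite Ha, Hx, Hy; auto.
  - intros a x Hx z Hz. destruct (Hu z) as [_ [Hs _]]. rewrite Hs, Hx; auto.
  - intros u l Hul Hl z Hz. apply hdist_small. intros eps He.
    destruct (Hl (eps / 2)) as [N HN]; [lra|]. specialize (HN N (le_n N)).
    (* Since [u N] is fixed by [pi z], the displacement of [l] is at most twice its distance to
       [u N]. *)
    assert (T := hdist_triangle V (pi z l) (u N) l).
    rewrite <- (Hul N z Hz) in T at 1. rewrite unitary_dist in T by apply Hu.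
    rewrite (hdist_sym V l) in T. lra.
Qed.

Lemma fixed_by_stable (Z : G -> Prop) :
  (forall g z, Z z -> mul z g = mul g z) ->
  forall g x, fixed_by Z x -> fixed_by Z (pi g x).
Proof.
  intros HZ g x Hx z Hz. destruct Hpi as [_ [Hm _]].
  rewrite <- Hm, HZ, Hm, Hx; auto.
Qed.

(** Unitarity moves [pi g] to the other argument as [pi (inv g)], which preserves [W]. *)
Lemma orthogonal_stable (W : V -> Prop) :
  (forall g x, W x -> W (pi g x)) ->
  forall g x, orthogonal V W x -> orthogonal V W (pi g x).
Proof.
  intros Ws g x Hx w Hw. destruct Hpi as [Hu [Hm [H1 _]]].
  assert (E : w = pi g (pi (inv g) w)) by (rewrite <- Hm, mul_inv; auto).
  rewrite E, unitary_rinner by apply Hu. apply Hx, Ws, Hw.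
Qed.

(** The displacement of the sum is the sum of the two displacements, which are orthogonal. By
    Pythagoras it dominates each of them. *)
Lemma orthogonal_split_displacement (W : V -> Prop) (HW : closed_subspace V W) :
  (forall g x, W x -> W (pi g x)) ->
  forall x0 x1, W x0 -> orthogonal V W x1 ->
  forall g, hdist V (pi g x0) x0 <= hdist V (pi g (hadd V x0 x1)) (hadd V x0 x1) /\
            hdist V (pi g x1) x1 <= hdist V (pi g (hadd V x0 x1)) (hadd V x0 x1).
Proof.
  intros Ws x0 x1 H0 H1 g.
  set (a := hsub V (pi g x0) x0). set (b := hsub V (pi g x1) x1).
  assert (Wa : W a).
  { apply (cs_add V W HW); [apply Ws, H0|]. apply (cs_opp V W HW), H0. }
  assert (Wb : orthogonal V W b).
  { assert (HO := orthogonal_closed V W HW).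
    apply (cs_add V _ HO); [apply orthogonal_stable; assumption|].
    apply (cs_opp V _ HO), H1. }
  assert (E : hsub V (pi g (hadd V x0 x1)) (hadd V x0 x1) = hadd V a b).
  { destruct Hpi as [Hu _]. destruct (Hu g) as [Ha _]. rewrite Ha. unfold a, b.
    vector_eq. }
  unfold hdist. rewrite E. fold a b. unfold hnorm.
  fold (rinner V a a) (rinner V b b) (rinner V (hadd V a b) (hadd V a b)).
  assert (Pa := rinner_pos V a). assert (Pb := rinner_pos V b).
  assert (Hab := Wb a Wa).
  split; apply sqrt_le_1_alt; rinner_expand; rewrite (rinner_sym V a b); lra.
Qed.

End InvariantSubspaces.

(** * The Heisenberg group *)

Lemma dot_pos n (u : vec n) : 0 <= dot n u u.
Proof. induction n; simpl; [lra|]. specialize (IHn (fun i => u (Fin.FS i))). nra. Qed.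

Lemma dot_comm n (u v : vec n) : dot n u v = dot n v u.
Proof. induction n; simpl; [reflexivity|]. rewrite IHn. ring. Qed.

Lemma dot_zeror n (u : vec n) : dot n u vzero = 0.
Proof. induction n; simpl; [reflexivity|]. unfold vzero in *. rewrite IHn. ring. Qed.

Definition vopp {n} (u : vec n) : vec n := fun i => - u i.

Lemma dot_oppr n (u v : vec n) : dot n u (vopp v) = - dot n u v.
Proof. induction n; simpl; [ring|]. unfold vopp in *. rewrite IHn. ring. Qed.

Lemma vadd_comm n (u v : vec n) : vadd u v = vadd v u.
Proof. extensionality i. apply Rplus_comm. Qed.

Lemma vadd_zerol n (u : vec n) : vadd vzero u = u.
Proof. extensionality i. apply Rplus_0_l. Qed.

Lemma vadd_opp n (u : vec n) : vadd u (vopp u) = vzero.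
Proof. extensionality i. apply Rplus_opp_r. Qed.

Lemma vsub_diag n (u : vec n) : vsub u u = vzero.
Proof. extensionality i. apply Rminus_diag. Qed.

Definition heis_inv {n} (g : Heis n) : Heis n :=
  (- fst g, (vopp (fst (snd g)), vopp (snd (snd g)))).

Lemma heis_mul_inv n (g : Heis n) : heis_mul g (heis_inv g) = heis_one.
Proof.
  destruct g as [t [q p]]. unfold heis_one, r2n_zero. simpl. rewrite !vadd_opp. f_equal.
  rewrite dot_oppr, (dot_comm n (vopp p)), dot_oppr, (dot_comm n q). ring.
Qed.

Definition centre_elt {n} (t : R) : Heis n := (t, r2n_zero).

Definition is_central {n} (g : Heis n) : Prop := exists t, g = centre_elt t.

Lemma centre_elt_mul n (t : R) (g : Heis n) :
  heis_mul (centre_elt t) g = (t + fst g, snd g).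
Proof.
  destruct g as [u [q p]]. simpl. rewrite !vadd_zerol, dot_zeror, dot_comm, dot_zeror.
  f_equal. ring.
Qed.

Lemma mul_centre_elt n (t : R) (g : Heis n) :
  heis_mul g (centre_elt t) = (t + fst g, snd g).
Proof.
  destruct g as [u [q p]]. simpl.
  rewrite !(vadd_comm n _ vzero), !vadd_zerol, dot_zeror, dot_comm, dot_zeror.
  f_equal. ring.
Qed.

Lemma is_central_comm n (g z : Heis n) : is_central z -> heis_mul z g = heis_mul g z.
Proof. intros [t ->]. rewrite centre_elt_mul, mul_centre_elt. reflexivity. Qed.

Lemma r2n_dist_pos n (a b : R2n n) : 0 <= r2n_dist a b.
Proof. apply sqrt_pos. Qed.

Lemma r2n_dist_le_heis_dist n (g h : Heis n) : r2n_dist (snd g) (snd h) <= heis_dist g h.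
Proof.
  unfold heis_dist. rewrite <- (sqrt_pow2 (r2n_dist (snd g) (snd h))) at 1
    by apply r2n_dist_pos.
  apply sqrt_le_1_alt. assert (H := pow2_ge_0 (fst g - fst h)). lra.
Qed.

Lemma heis_dist_same_fst n (t : R) (a b : R2n n) : heis_dist (t, a) (t, b) = r2n_dist a b.
Proof.
  unfold heis_dist. simpl fst. simpl snd.
  replace ((t - t) ^ 2 + r2n_dist a b ^ 2) with (r2n_dist a b ^ 2) by ring.
  apply sqrt_pow2, r2n_dist_pos.
Qed.

Lemma r2n_dist_diag n (a : R2n n) : r2n_dist a a = 0.
Proof.
  unfold r2n_dist. rewrite !vsub_diag, !dot_zeror, Rplus_0_l. apply sqrt_0.
Qed.

Lemma heis_dist_centre_elt n (s t : R) :
  heis_dist (@centre_elt n s) (centre_elt t) = Rabs (s - t).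
Proof.
  unfold heis_dist, centre_elt. simpl fst. simpl snd. rewrite r2n_dist_diag, <- sqrt_Rsqr_abs.
  f_equal. unfold Rsqr. ring.
Qed.

(** * Commutators with a small shift *)

Definition axis {m} (r : R) : vec (S m) :=
  fun i => match i with Fin.F1 => r | Fin.FS _ => 0 end.

Lemma dot_axis m (u : vec (S m)) (r : R) : dot (S m) u (axis r) = r * u Fin.F1.
Proof.
  simpl. change (fun i : Fin.t m => 0) with (@vzero m). rewrite dot_zeror. ring.
Qed.

(** The element written s in the overview: for [r > 0] it is non-central, at distance exactly [r]
    from the identity. *)
Definition shift {m} (r : R) : Heis (S m) := (0, (axis r, vzero)).

Lemma shift_dist m (r : R) : 0 <= r -> heis_dist heis_one (@shift m r) = r.
Proof.
  intro Hr. unfold heis_one, shift. rewrite heis_dist_same_fst. unfold r2n_dist, r2n_zero.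
  simpl fst. simpl snd. rewrite vsub_diag, dot_zeror.
  replace (vsub vzero (axis r)) with (@axis m (- r)).
  - rewrite dot_axis. simpl. rewrite Rplus_0_r, <- (sqrt_square r) by assumption.
    f_equal. rewrite sqrt_square by assumption. ring.
  - extensionality i. unfold vsub, vzero, axis.
    refine (match i with Fin.F1 => _ | Fin.FS _ => _ end); ring.
Qed.

(** The two orders of multiplication contribute half of [r] times the first momentum coordinate with
    opposite signs. The commutator is therefore central and depends only on the projection of
    [g]. *)
Lemma shift_commutator m (r : R) (g : Heis (S m)) :
  heis_mul g (shift r) =
  heis_mul (heis_mul (centre_elt (r * snd (snd g) Fin.F1)) (shift r)) g.
Proof.
  rewrite centre_elt_mul. destruct g as [t [q p]]. unfold shift.
  cbn [heis_mul fst snd].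
  rewrite (dot_comm _ vzero), dot_zeror, dot_axis.
  rewrite (vadd_comm _ q), (vadd_comm _ p). f_equal. field.
Qed.

Lemma coord_dist_le m (a b : R2n (S m)) :
  Rabs (snd a Fin.F1 - snd b Fin.F1) <= r2n_dist a b.
Proof.
  unfold r2n_dist. rewrite <- sqrt_Rsqr_abs. apply sqrt_le_1_alt.
  assert (H := dot_pos _ (vsub (fst a) (fst b))).
  assert (K : Rsqr (snd a Fin.F1 - snd b Fin.F1) <=
              dot (S m) (vsub (snd a) (snd b)) (vsub (snd a) (snd b))).
  { simpl. assert (L := dot_pos m (fun i => vsub (snd a) (snd b) (Fin.FS i))).
    unfold Rsqr, vsub at 1 2. lra. }
  lra.
Qed.

Lemma central_pullback_sc m (V : HilbertSpace) (rho : Heis (S m) -> V -> V) (r : R) :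
  sc_unitary_rep heis_mul heis_one heis_dist V rho ->
  sc_unitary_rep r2n_add r2n_zero r2n_dist V
    (fun a : R2n (S m) => rho (centre_elt (r * snd a Fin.F1))).
Proof.
  intros [Hu [Hm [H1 Hc]]]. split; [|split; [|split]].
  - intro a. apply Hu.
  - intros a b x. rewrite <- Hm. rewrite centre_elt_mul. f_equal.
    unfold centre_elt. simpl. unfold vadd. f_equal. ring.
  - intro x. replace (centre_elt (r * snd r2n_zero Fin.F1)) with (@heis_one (S m)).
    + apply H1.
    + unfold centre_elt, heis_one. f_equal. simpl. unfold vzero. ring.
  - intros a x eps He.
    destruct (Hc (centre_elt (r * snd a Fin.F1)) x eps He) as [d [Hd Hd']].
    assert (Pr := Rabs_pos r).
    (* The homomorphism to the centre is Lipschitz with constant |[r]|; adding 1 allows [r = 0]. *)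
    exists (d / (Rabs r + 1)). split; [apply Rdiv_lt_0_compat; lra|].
    intros b Hb. apply Hd'. rewrite heis_dist_centre_elt.
    replace (r * snd a Fin.F1 - r * snd b Fin.F1) with (r * (snd a Fin.F1 - snd b Fin.F1)) by ring.
    rewrite Rabs_mult. assert (C := coord_dist_le m a b).
    assert (P := Rabs_pos (snd a Fin.F1 - snd b Fin.F1)).
    apply (Rmult_lt_compat_r (Rabs r + 1)) in Hb; [|lra].
    unfold Rdiv in Hb. rewrite Rmult_assoc, Rinv_l, Rmult_1_r in Hb; nra.
Qed.

(** * Transfer of Kazhdan sets between the two groups *)

Definition Kazhdan_pair {G : Type} (mul : G -> G -> G) (one : G) (dist : G -> G -> R)
  (Q : G -> Prop) (eps : R) : Prop :=
  forall (V : HilbertSpace) (pi : G -> V -> V),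
    sc_unitary_rep mul one dist V pi ->
    forall x : V,
      (exists c, 0 <= c /\ c < eps * hnorm V x /\
         forall g, Q g -> hnorm V (hsub V (pi g x) x) <= c) ->
      exists y : V, y <> hzero V /\ forall g, pi g y = y.

Lemma exists_central_fixed_vector m (Q : Heis (S m) -> Prop) eps
  (V : HilbertSpace) (rho : Heis (S m) -> V -> V) x c :
  Kazhdan_pair (@r2n_add (S m)) r2n_zero r2n_dist (image_proj Q) eps ->
  sc_unitary_rep heis_mul heis_one heis_dist V rho ->
  0 <= c -> 2 * c < eps * hnorm V x ->
  (forall g, Q g -> hdist V (rho g x) x <= c) ->
  exists y, y <> hzero V /\ fixed_by V rho is_central y.
Proof.
  intros HK Hrho Hc0 Hc HQ. assert (Hrho' := Hrho).
  destruct Hrho' as [Hu [Hm [H1 Hcont]]].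
  (* This makes [2 * c + 2 * eta] the midpoint of [2 * c] and [eps * hnorm V x]. *)
  set (eta := (eps * hnorm V x - 2 * c) / 4).
  destruct (Hcont heis_one x eta) as [d [Hd Hd']]; [unfold eta; lra|].
  (* Strictly below [d] for continuity, and non-zero so that the commutators fill the centre. *)
  set (r := d / 2).
  assert (Hs : hdist V (rho (shift r) x) x < eta).
  { specialize (Hd' (shift r)). rewrite H1 in Hd'. apply Hd'.
    rewrite shift_dist; unfold r; lra. }
  destruct (HK V _ (central_pullback_sc m V rho r Hrho) (rho (shift r) x)) as [y [Hy0 Hy]].
  { exists (2 * c + 2 * eta). split; [|split].
    - unfold eta. lra.
    - rewrite unitary_norm by apply Hu. unfold eta. lra.
    - intros a [g [Hg <-]]. unfold proj_n.
      change (hdist V (rho (centre_elt (r * snd (snd g) Fin.F1)) (rho (shift r) x))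
                (rho (shift r) x) <= 2 * c + 2 * eta).
      set (z := centre_elt _). specialize (HQ g Hg).
      assert (E : rho z (rho (shift r) (rho g x)) = rho g (rho (shift r) x)).
      { rewrite <- (Hm g), shift_commutator, !Hm. reflexivity. }
      (* [T1] costs [c] for replacing [x] by [rho g x], [T2] costs [eta], and [T3] costs
         [c + eta]. *)
      assert (T1 := hdist_triangle V (rho z (rho (shift r) x))
                      (rho z (rho (shift r) (rho g x))) (rho (shift r) x)).
      rewrite !unitary_dist in T1 by apply Hu. rewrite E, (hdist_sym V x) in T1.
      assert (T2 := hdist_triangle V (rho g (rho (shift r) x)) (rho g x) (rho (shift r) x)).
      rewrite unitary_dist in T2 by apply Hu.
      assert (T3 := hdist_triangle V (rho g x) x (rho (shift r) x)).
      rewrite (hdist_sym V x (rho (shift r) x)) in T3. lra. }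
  exists y. split; [assumption|]. intros z [t ->].
  (* A preimage of the central element [t] under the homomorphism used for the pullback. *)
  specialize (Hy (vzero, axis (t / r))). simpl in Hy.
  replace (r * (t / r)) with t in Hy; [exact Hy|]. unfold r. field. lra.
Qed.

Section CentralFixed.
Variables (n : nat) (V : HilbertSpace) (rho : Heis n -> V -> V).
Hypothesis Hrho : sc_unitary_rep heis_mul heis_one heis_dist V rho.
Hypothesis Hfix : forall x, fixed_by V rho is_central x.

Lemma central_fixed_fst (t : R) (a : R2n n) (x : V) : rho (t, a) x = rho (0, a) x.
Proof.
  destruct Hrho as [_ [Hm _]].
  assert (E : (t, a) = heis_mul (0, a) (centre_elt t)).
  { rewrite mul_centre_elt. simpl. f_equal. ring. }
  rewrite E, Hm, (Hfix x (centre_elt t)); [reflexivity|]. exists t. reflexivity.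
Qed.

(** The section [a] to [(0, a)] is multiplicative only up to a central factor, and that factor acts
    trivially here. *)
Lemma central_quotient_sc :
  sc_unitary_rep r2n_add r2n_zero r2n_dist V (fun a => rho (0, a)).
Proof.
  destruct Hrho as [Hu [Hm [H1 Hc]]]. split; [|split; [|split]].
  - intro a. apply Hu.
  - intros [q p] [q' p'] x. rewrite <- Hm. simpl. symmetry. apply central_fixed_fst.
  - apply H1.
  - intros a x eps He. destruct (Hc (0, a) x eps He) as [d [Hd Hd']].
    exists d. split; [assumption|]. intros b Hb. apply Hd'.
    rewrite heis_dist_same_fst. assumption.
Qed.

End CentralFixed.

Lemma Kazhdan_set_image n (Q : Heis n -> Prop) :
  Kazhdan_set (@heis_mul n) heis_one heis_dist Q ->
  Kazhdan_set (@r2n_add n) r2n_zero r2n_dist (image_proj Q).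
Proof.
  intros [eps [He HK]]. exists eps. split; [assumption|].
  intros V pi [Hu [Hm [H1 Hc]]] x [c [Hc0 [Hcx HQ]]].
  destruct (HK V (fun g => pi (proj_n g))) with (x := x) as [y [Hy0 Hy]].
  - split; [|split; [|split]].
    + intro g. apply Hu.
    + intros [t [q p]] [t' [q' p']] v. exact (Hm (q, p) (q', p') v).
    + apply H1.
    + intros g v e Pe. destruct (Hc (proj_n g) v e Pe) as [d [Hd Hd']].
      exists d. split; [assumption|]. intros h Hh. apply Hd'.
      eapply Rle_lt_trans; [apply r2n_dist_le_heis_dist | exact Hh].
  - exists c. split; [assumption|]. split; [assumption|].
    intros g Hg. apply HQ. exists g. auto.
  - exists y. split; [assumption|]. intro a. exact (Hy (0, a)).
Qed.

Lemma Kazhdan_set_preimage m (Q : Heis (S m) -> Prop) :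
  Kazhdan_set (@r2n_add (S m)) r2n_zero r2n_dist (image_proj Q) ->
  Kazhdan_set (@heis_mul (S m)) heis_one heis_dist Q.
Proof.
  (* One factor 2 is lost because only one of [x0], [x1] is sure to have at least half the norm of
     [x], the other because [exists_central_fixed_vector] needs [2 * c] below the threshold. *)
  intros [eps [He HK]]. exists (eps / 4). split; [lra|].
  intros V rho Hrho x [c [Hc0 [Hcx HQ]]].
  set (W := fixed_by V rho is_central).
  assert (HW : closed_subspace V W) by (eapply fixed_by_closed; eassumption).
  assert (HO := orthogonal_closed V W HW).
  assert (Ws : forall g v, W v -> W (rho g v)).
  { eapply fixed_by_stable; [eassumption|]. intros g z. apply is_central_comm. }
  assert (Os := orthogonal_stable _ _ _ _ (@heis_mul_inv (S m)) V rho Hrho W Ws).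
  destruct (projection_exists V W HW x) as [x0 [Hx0 Hx1]].
  set (x1 := hsub V x x0) in *.
  assert (Ex : x = hadd V x0 x1) by (unfold x1; vector_eq).
  assert (HQ01 := orthogonal_split_displacement _ _ _ _ (@heis_mul_inv (S m)) V rho Hrho
                    W HW Ws x0 x1 Hx0 Hx1).
  rewrite <- Ex in HQ01.
  assert (T := hnorm_triangle V x0 x1). rewrite <- Ex in T.
  destruct (Rle_lt_dec (hnorm V x) (2 * hnorm V x0)) as [Hbig|Hbig].
  - set (R0 := restrict_rep V rho W HW Ws).
    assert (HR0 : sc_unitary_rep heis_mul heis_one heis_dist (sub_hilbert V W HW) R0)
      by apply (restrict_rep_sc _ _ _ _ (@heis_mul_inv (S m)) V rho Hrho).
    assert (Hfix : forall v, fixed_by (sub_hilbert V W HW) R0 is_central v).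
    { intros v z Hz. apply subspace_eq. exact (proj2_sig v z Hz). }
    destruct (HK _ _ (central_quotient_sc _ _ R0 HR0 Hfix) (exist _ x0 Hx0)) as [y [Hy0 Hy]].
    { exists c. split; [assumption|]. split.
      - change (c < eps * hnorm V x0). nra.
      - intros a [g [Hg <-]]. rewrite <- (central_fixed_fst _ _ R0 HR0 Hfix (fst g)).
        unfold proj_n. rewrite <- surjective_pairing.
        change (hdist V (rho g x0) x0 <= c).
        eapply Rle_trans; [apply HQ01 | apply HQ, Hg]. }
    exists (proj1_sig y). split.
    + intro E. apply Hy0. apply subspace_eq. exact E.
    + intros [t a]. specialize (Hy a).
      rewrite <- (central_fixed_fst _ _ R0 HR0 Hfix t) in Hy.
      exact (f_equal (@proj1_sig _ _) Hy).
  - exfalso.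
    destruct (exists_central_fixed_vector m Q eps (sub_hilbert V _ HO)
                (restrict_rep V rho _ HO Os) (exist _ x1 Hx1) c) as [y [Hy0 Hy]].
    + exact HK.
    + apply (restrict_rep_sc _ _ _ _ (@heis_mul_inv (S m)) V rho Hrho).
    + assumption.
    + change (2 * c < eps * hnorm V x1). nra.
    + intros g Hg. change (hdist V (rho g x1) x1 <= c).
      eapply Rle_trans; [apply HQ01 | apply HQ, Hg].
    (* The vector [y] lies both in [W] and in its orthogonal complement, so it is orthogonal to
       itself. *)
    + destruct y as [y Oy].
      assert (Wy : W y).
      { intros z Hz. exact (f_equal (@proj1_sig _ _) (Hy z Hz)). }
      apply Hy0, subspace_eq. apply hinner_def. exact (Oy y Wy).
Qed.

Theorem mainTheorem14 : forall (n : nat), (1 <= n)%nat -> forall Q : Heis n -> Prop,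
  Kazhdan_set (@heis_mul n) (@heis_one n) (@heis_dist n) Q <->
  Kazhdan_set (@r2n_add n) (@r2n_zero n) (@r2n_dist n) (image_proj Q).
Proof.
  intros n Hn Q. destruct n as [|m]; [lia|].
  split; [apply Kazhdan_set_image | apply Kazhdan_set_preimage].
Qed.
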